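(* Let $\epsilon,\delta>0$, let $T$ be the number of iterations of the Dense-MW LP algorithm (described in the context), let $s\in\mathbb{N}$ be its density parameter, and let $\epsilon'=\epsilon/\sqrt{8T\log(1/\delta)}$. Suppose the oracle used by the algorithm is $\epsilon'$-private in the following sense: for all pairs of inputs $(\tilde y,A,b)$ and $(\tilde y',A',b')$ such that $\|\tilde y\|_\infty\le 1/s$, $\|\tilde y'\|_\infty\le1/s$, $\|\tilde y-\tilde y'\|_1\le 2/s$, the matrices $A,A'$ are identical except that one has one additional row, and $b,b'$ are identical except that one has the corresponding additional entry, the output distributions $P,P'$ of the oracle satisfy $P(S)\le e^{\epsilon'}P'(S)$ for all measurable $S$ (in both directions). Then the Dense-MW LP algorithm with density $s$ is $(\epsilon,\delta)$-high sensitivity constraint private.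
   Context: Setting: linear feasibility problems ''find $x\in\mathcal{K}$ with $Ax\le b$'' with $A\in\mathbb{R}^{m\times d}$, $b\in\mathbb{R}^m$, and a public convex set $\mathcal{K}\subseteq\mathbb{R}^d$; $\rho$ is a data-independent upper bound on $\max_{x\in\mathcal{K}}\|Ax-b\|_\infty$, and $\alpha>0$ is an accuracy parameter. A randomized algorithm $\mathcal{M}$ taking inputs $m\in\mathbb{N}$, $b\in\mathbb{R}^m$, $A\in\mathbb{R}^{m\times d}$ and outputting a vector of $\mathbb{R}^d$ is $(\epsilon,\delta)$-high sensitivity constraint private if for all $A,A'$ such that $A'$ equals $A$ with one additional row appended, and $b,b'$ such that $b'$ equals $b$ with one additional entry, $\Pr[\mathcal{M}(m,b,A)\in S]\le e^\epsilon\Pr[\mathcal{M}(m+1,b',A')\in S]+\delta$ for every $S\subseteq\mathbb{R}^d$. Bregman projection: for a measure $A$ on a finite set with total mass at most $s$, $\Pi_s(A)_a=\frac1s\min\{1,cA_a\}$ where $c\ge0$ satisfies $\sum_a\min\{1,cA_a\}=s$. Dense multiplicative weights $DMW_{s,\eta}$: start with the uniform measure $A^1$; at each step output $\tilde B^t=\Pi_s(A^t)$, receive losses $\ell^t$, update $A^{t+1}_a=e^{-\eta\ell^t_a}A^t_a$. Dense-MW LP algorithm: $T=36\rho^2\log m/\alpha^2$, $\eta=\sqrt{\log m/T}$, $\tilde y^1$ uniform on $[m]$; for $t=1,\dots,T$: $x^t=\mathrm{Oracle}(\tilde y^t,A)$ (the oracle may also use $b$), losses $\ell^t_i=\frac{1}{2\rho}(b_i-A_i\cdot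 x^t)+\frac12$, and $\tilde y^{t+1}$ is obtained by $DMW_{s,\eta}$ over $[m]$ with these losses; output $\bar x=\frac1T\sum_t x^t$. (When comparing runs on instances with $m$ and $m+1$ constraints, distributions on $[m]$ are viewed as distributions on $[m+1]$ with weight $0$ on the extra constraint.)
   Formalization: For δ<1 it is also assumed that ε ≤ 8 log(1/δ), without which the claim fails; the two compared runs share the same T (rounded up to an integer) and η, computed from a public number; privacy is claimed for instances with at least s ≥ 1 constraints, where the projection exists. *)

(* Defs.v *)
(* MathComp / MathComp-Analysis.

   Vectors that carry probability (oracle outputs in R^d, distributions on [m])
   are tuples, because n.-tuple R has the product sigma-algebra of R^n as its
   canonical measurable structure; the LP data A, b are matrices. *)
From HB Require Import structures.
From mathcomp Require Export all_boot all_order all_algebra.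
From mathcomp Require Export all_classical all_reals all_analysis.

Set Implicit Arguments.
Unset Strict Implicit.
Unset Printing Implicit Defensive.

Import Order.TTheory GRing.Theory Num.Theory.

Local Open Scope classical_set_scope.
Local Open Scope ring_scope.

Definition is_distribution (R : realType) (m : nat) (y : m.-tuple R) : Prop :=
  (forall i, 0 <= tnth y i) /\ \sum_(i < m) tnth y i = 1.

Definition linf_norm (R : realType) (m : nat) (y : m.-tuple R) : R :=
  \big[Num.max/0]_(i < m) `|tnth y i|.

(* y on [m] is viewed on [m+1] with weight 0 on the extra (last) constraint. *)
Definition l1_dist_ext (R : realType) (m : nat)
    (y : m.-tuple R) (y' : m.+1.-tuple R) : R :=
  \sum_(i < m.+1) `|tnth [tuple of rcons y 0] i - tnth y' i|.

Definition uniform_tuple (R : realType) (m : nat) : m.-tuple R :=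
  [tuple m%:R^-1 | i < m].

(* The scaling constant is not unique only in degenerate cases (such as s = m),
   where every admissible c gives the same projection.  If there is no
   admissible c (e.g. s > m), the value is the junk constant 0. *)
Definition bregman_const (R : realType) (s m : nat) (w : m.-tuple R) : R :=
  xget 0 [set c | 0 <= c /\
                  \sum_(i < m) Num.min 1 (c * tnth w i) = s%:R].

Definition bregman_proj (R : realType) (s m : nat) (w : m.-tuple R) :
    m.-tuple R :=
  [tuple s%:R^-1 * Num.min 1 (bregman_const s w * tnth w i) | i < m].

Definition add_tuple (R : realType) (d : nat) (u x : d.-tuple R) : d.-tuple R :=
  [tuple tnth u j + tnth x j | j < d].

Definition mw_update (R : realType) (eta : R) (m : nat)
    (w l : m.-tuple R) : m.-tuple R :=
  [tuple expR (- (eta * tnth l i)) * tnth w i | i < m].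

Definition lp_loss (R : realType) (d : nat) (rho : R) (m : nat)
    (A : 'M[R]_(m, d)) (b : 'cV[R]_m) (x : d.-tuple R) : m.-tuple R :=
  [tuple (2 * rho)^-1 * (b i 0 - \sum_(j < d) A i j * tnth x j) + 2^-1 | i < m].

(* For each m and each instance (A, b) with m constraints, a probability kernel
   from weight vectors on [m] to R^d; its being a kernel is the measurability in
   the weights needed to compose the rounds. *)
Definition lp_oracle (R : realType) (d : nat) : Type :=
  forall m : nat, 'M[R]_(m, d) -> 'cV[R]_m ->
    R.-pker (m.-tuple R) ~> (d.-tuple R).

(* Probability that the average of all T iterates lies in S, when k rounds
   remain, y is the next oracle query, w the current (unprojected) measure of
   multiplicative weights, and u the sum of the iterates produced so far; the
   next iterate x has distribution [orc m A b y]. *)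
Fixpoint dense_mw_run (R : realType) (d : nat) (orc : lp_oracle R d)
    (s : nat) (eta rho : R) (m : nat) (A : 'M[R]_(m, d)) (b : 'cV[R]_m)
    (T k : nat) (y w : m.-tuple R) (u : d.-tuple R)
    (S : set (d.-tuple R)) {struct k} : \bar R :=
  match k with
  | 0%N => \d_([tuple T%:R^-1 * tnth u j | j < d] : d.-tuple R) S
  | k'.+1 =>
      (\int[orc m A b y]_x
         (let w' := mw_update eta w (lp_loss rho A b x) in
          dense_mw_run orc s eta rho A b T k' (bregman_proj s w') w'
            (add_tuple u x) S))%E
  end.

(* T = 36 rho^2 log n / alpha^2, rounded up to an integer. *)
Definition dense_mw_rounds (R : realType) (rho alpha : R) (n : nat) : nat :=
  `|Num.ceil (36 * rho ^+ 2 * ln (n%:R : R) / alpha ^+ 2)|%N.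

Definition dense_mw_rate (R : realType) (rho alpha : R) (n : nat) : R :=
  Num.sqrt (ln (n%:R : R) / (dense_mw_rounds rho alpha n)%:R).

(* Output distribution on the instance (b, A) with m constraints.  The public
   number n from which T and eta are computed is separate from m: two runs on
   neighbouring instances use the same T and eta. *)
Definition dense_mw_lp (R : realType) (d : nat) (orc : lp_oracle R d)
    (s : nat) (rho alpha : R) (n : nat)
    (m : nat) (b : 'cV[R]_m) (A : 'M[R]_(m, d)) : set (d.-tuple R) -> \bar R :=
  let T := dense_mw_rounds rho alpha n in
  dense_mw_run orc s (dense_mw_rate rho alpha n) rho A b T T
    (uniform_tuple R m) (uniform_tuple R m) [tuple 0 | j < d].

Definition appends_constraint (R : realType) (d m : nat)
    (A : 'M[R]_(m, d)) (b : 'cV[R]_m)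
    (A' : 'M[R]_(m.+1, d)) (b' : 'cV[R]_m.+1) : Prop :=
  row' ord_max A' = A /\ row' ord_max b' = b.

(* mmin is the least number of constraints for which M is meaningful: M m is
   constrained only for m >= mmin. *)
Definition high_sensitivity_constraint_private (R : realType) (d mmin : nat)
    (M : forall m : nat, 'cV[R]_m -> 'M[R]_(m, d) -> set (d.-tuple R) -> \bar R)
    (eps delta : R) : Prop :=
  forall m : nat, (mmin <= m)%N ->
  forall (A : 'M[R]_(m, d)) (b : 'cV[R]_m)
         (A' : 'M[R]_(m.+1, d)) (b' : 'cV[R]_m.+1),
    appends_constraint A b A' b' ->
  forall S : set (d.-tuple R), measurable S ->
    (M m b A S <= (expR eps)%:E * M m.+1 b' A' S + delta%:E)%E.

Definition private_oracle (R : realType) (d s : nat) (orc : lp_oracle R d)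
    (eps : R) : Prop :=
  forall (m : nat) (y : m.-tuple R) (A : 'M[R]_(m, d)) (b : 'cV[R]_m)
         (y' : m.+1.-tuple R) (A' : 'M[R]_(m.+1, d)) (b' : 'cV[R]_m.+1),
    is_distribution y -> is_distribution y' ->
    linf_norm y <= s%:R^-1 -> linf_norm y' <= s%:R^-1 ->
    l1_dist_ext y y' <= 2 / s%:R ->
    appends_constraint A b A' b' ->
  forall S : set (d.-tuple R), measurable S ->
    (orc m A b y S <= (expR eps)%:E * orc m.+1 A' b' y' S)%E /\
    (orc m.+1 A' b' y' S <= (expR eps)%:E * orc m A b y S)%E.

(* Main.v *)
Require Import Defs.
From HB Require Import structures.
From mathcomp Require Import all_boot all_order all_algebra.
From mathcomp Require Import all_classical all_reals all_analysis.
From mathcomp Require Import measurable_realfun.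
From mathcomp Require Import ring lra.
Set Implicit Arguments.
Unset Strict Implicit.
Unset Printing Implicit Defensive.
Import Order.TTheory GRing.Theory Num.Theory.
Import numFieldNormedType.Exports.
Local Open Scope classical_set_scope.
Local Open Scope ring_scope.

(* After the same iterates, the weights of two runs on neighbouring instances
   are proportional on the common constraints, so their Bregman projections are
   within l1 distance 2/s and every oracle call is e-private, where e is the
   eps' of the statement.  A pair (P, P') of mutually e-private distributions is
   a post-processing of randomized response: P and P' are the mixtures of two
   distributions U and V with weights (exp e : 1) and (1 : exp e).  Hence, if
   for all real t the probabilities F, G of a final event given one round
   satisfy F <= exp t * G + M * exp (- mu t), then after averaging over the
   round the same holds with M multiplied by
     (exp (e (1 + mu)) + exp (- e mu)) / (1 + exp e)
       <= exp (mu (mu + 1) e^2 / 2),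
   where the inequality holds because cosh a * exp (- a^2 / 2) decreases on
   a >= 0.  Iterating over the T rounds from M = 1 and taking t = eps and
   mu = 4 ln (1 / delta) / eps makes the additive term at most delta. *)

(** * Monotonicity of the Gaussian-damped cosh, and the moment bound for one round *)

Lemma le0_is_derive_nincry (R : realType) (f f' : R -> R) (a : R) :
  (forall x : R, is_derive x 1 f (f' x)) ->
  (forall x, a <= x -> f' x <= 0) ->
  forall x y, a <= x -> x <= y -> f y <= f x.
Proof.
move=> df f'0; apply: ler0_derive1_nincry.
- by move=> x _; apply: ex_derive.
- move=> x; rewrite in_itv/= andbT => /ltW ax.
  by rewrite derive1E; have -> := derive_val (is_derive := df x); exact: f'0.
- apply: continuous_subspaceT => x.
  by apply/differentiable_continuous/derivable1_diffP; exact: ex_derive.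
Qed.

Lemma cosh_gauss_nincr (R : realType) (x y : R) : 0 <= x -> x <= y ->
  (expR y + expR (- y)) * expR (- (y ^+ 2 / 2)) <=
  (expR x + expR (- x)) * expR (- (x ^+ 2 / 2)).
Proof.
(* [h] is the derivative of the damped sum divided by its Gaussian factor. It vanishes at 0 and has
   derivative [- (a * (expR a - expR (- a)))], so it is nonpositive for [a >= 0]. *)
pose h (a : R) : R := (1 - a) * expR a - (1 + a) * expR (- a).
have h_le0 a : 0 <= a -> h a <= 0.
  move=> a0; have -> : 0 = h 0 by rewrite /h oppr0; ring.
  apply: (@le0_is_derive_nincry _ h (fun a => - (a * (expR a - expR (- a)))) 0) => //.
    move=> z; apply: is_derive_eq; rewrite /GRing.scale/= ; ring.
  move=> z z0; rewrite oppr_le0 mulr_ge0// subr_ge0 ler_expR; lra.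
apply: (@le0_is_derive_nincry _ (fun a => (expR a + expR (- a)) * expR (- (a ^+ 2 / 2)))
  (fun a => h a * expR (- (a ^+ 2 / 2)))).
  move=> z; apply: is_derive_eq; rewrite /h /GRing.scale/= !mulr1 mulr0 mulr0 add0r.
  have -> : 2^-1 * (z + z) = z by lra.
  ring.
by move=> z /h_le0 hz; rewrite mulr_le0_ge0// expR_ge0.
Qed.

(** With [x = e / 2] and [y = e * mu + e / 2], both sums split off a factor [expR x] and become
    [expR y + expR (- y)] and [expR x + expR (- x)]. Since
    [y ^+ 2 - x ^+ 2 = mu * (mu + 1) * e ^+ 2], the claim is the monotonicity above between [x] and
    [y]. *)
Lemma randomized_response_mgf (R : realType) (e mu : R) : 0 <= e -> 0 <= mu ->
  expR (e * (1 + mu)) + expR (- (e * mu)) <=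
  (1 + expR e) * expR (mu * (mu + 1) * e ^+ 2 / 2).
Proof.
move=> e0 mu0.
have x0 : 0 <= e / 2 by lra.
have xy : e / 2 <= e * mu + e / 2 by have := mulr_ge0 e0 mu0; lra.
have := cosh_gauss_nincr x0 xy.
set x := e / 2; set y := e * mu + e / 2.
move=> H; rewrite -ler_pdivlMr ?expR_gt0// -expRN opprK -mulrA -expRD in H.
have -> : e * (1 + mu) = x + y by rewrite /x /y; lra.
have -> : - (e * mu) = x - y by rewrite /x /y; lra.
have -> : 1 + expR e = expR x * (expR x + expR (- x)).
  by rewrite mulrDr -!expRD subrr expR0 addrC; congr (expR _ + _); rewrite /x; lra.
have -> : mu * (mu + 1) * e ^+ 2 / 2 = - (x ^+ 2 / 2) + y ^+ 2 / 2.
  by rewrite /x /y; field.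
by rewrite (expRD x y) (expRD x (- y)) -mulrDr -mulrA ler_pM2l ?expR_gt0.
Qed.

(** * Integrals of bounded functions under mutually private distributions *)

Lemma bounded_integrableT {d} {X : measurableType d} {R : realType}
    (P : {measure set X -> \bar R}) (f : X -> R) (a b : R) :
  P setT = 1%E -> measurable_fun setT f -> (forall x, a <= f x <= b) ->
  P.-integrable setT (EFin \o f).
Proof.
move=> P1 mf fab; apply: measurable_bounded_integrable => //.
  by rewrite P1 ltry.
exists (`|a| + `|b|); split; first exact: num_real.
move=> M abM x _ /=; have /andP[af fb] := fab x.
apply: le_trans (ltW abM); rewrite ler_norml.
have := ler_norm b; have := ler_norm (- a); rewrite normrN;
  have := normr_ge0 a; have := normr_ge0 b.
lra.
Qed.

Lemma Rintegral_le_of_measure_le {d} {X : measurableType d} {R : realType}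
    (P Q : {measure set X -> \bar R}) (c : R) (h : X -> R) :
  0 <= c -> (forall A, measurable A -> (P A <= c%:E * Q A)%E) ->
  (forall x, 0 <= h x) -> measurable_fun setT h ->
  Q.-integrable setT (EFin \o h) ->
  \int[P]_x h x <= c * \int[Q]_x h x.
Proof.
move=> c0 PQ h0 mh iQ.
have /measurable_EFinP mEh := mh.
have Eh0 x : (0 <= (h x)%:E)%E by rewrite lee_fin.
have PQh : (\int[P]_x (h x)%:E <= c%:E * \int[Q]_x (h x)%:E)%E.
  have := @ge0_le_measure_integral _ _ _ P (mscale (NngNum c0) Q) PQ
    (fun x => (h x)%:E) setT measurableT Eh0 mEh.
  by rewrite ge0_integral_mscale.
have Qfin : (\int[Q]_x (h x)%:E)%E \is a fin_num by exact: integrable_fin_num.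
rewrite -lee_fin EFinM /Rintegral [X in (_ * X)%E]fineK//.
rewrite fineK// ge0_fin_numE; last exact: integral_ge0.
by apply: le_lt_trans PQh _; rewrite -(fineK Qfin) -EFinM ltry.
Qed.

Lemma Rintegral_affineB {d} {X : measurableType d} {R : realType}
    (P : {measure set X -> \bar R}) (f g : X -> R) (a M : R) :
  P setT = 1%E ->
  P.-integrable setT (EFin \o f) -> P.-integrable setT (EFin \o g) ->
  P.-integrable setT (EFin \o (fun x => a * g x + M - f x)) /\
  \int[P]_x (a * g x + M - f x) = a * \int[P]_x g x + M - \int[P]_x f x.
Proof.
move=> P1 fi gi.
have Mi : P.-integrable setT (EFin \o (fun=> M)).
  by apply: (@bounded_integrableT _ _ _ _ _ M M) => // x; rewrite lexx.
have agi : P.-integrable setT (EFin \o (fun x => a * g x)).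
  by under [_ \o _]eq_fun do rewrite /= EFinM; exact: integrableZl.
have agMi : P.-integrable setT (EFin \o (fun x => a * g x + M)).
  by under [_ \o _]eq_fun do rewrite /= EFinD; exact: integrableD.
split.
  by under [_ \o _]eq_fun do rewrite /= EFinB; exact: integrableB.
by rewrite RintegralB// RintegralD// RintegralZl// Rintegral_cst// P1 mulr1.
Qed.

(* [P] and [P'] are the mixtures of [U = (e^e P - P') / (e^e - 1)] and
   [V = (e^e P' - P) / (e^e - 1)] with weights [e^e : 1] and [1 : e^e]; the two
   hypotheses on [f] are integrated against [U] and [V] respectively. *)
Lemma pure_privacy_integral_le {d} {X : measurableType d} {R : realType}
    (P P' : {measure set X -> \bar R}) (e t M1 M2 : R) (f g : X -> R) :
  0 < e -> P setT = 1%E -> P' setT = 1%E ->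
  (forall A, measurable A -> (P A <= (expR e)%:E * P' A)%E) ->
  (forall A, measurable A -> (P' A <= (expR e)%:E * P A)%E) ->
  measurable_fun setT f -> measurable_fun setT g ->
  (forall x, 0 <= f x <= 1) -> (forall x, 0 <= g x <= 1) ->
  (forall x, f x <= expR (t - e) * g x + M1) ->
  (forall x, f x <= expR (t + e) * g x + M2) ->
  (1 + expR e) * \int[P]_x f x <=
    (1 + expR e) * (expR t * \int[P']_x g x) + (expR e * M1 + M2).
Proof.
move=> e0 P1 P'1 PP' P'P mf mg f01 g01 H1 H2.
have fi := bounded_integrableT P1 mf f01.
have f'i := bounded_integrableT P'1 mf f01.
have gi := bounded_integrableT P1 mg g01.
have g'i := bounded_integrableT P'1 mg g01.
have [i1 I1] := Rintegral_affineB (expR (t - e)) M1 P1 fi gi.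
have [_ I1'] := Rintegral_affineB (expR (t - e)) M1 P'1 f'i g'i.
have [_ I2] := Rintegral_affineB (expR (t + e)) M2 P1 fi gi.
have [i2 I2'] := Rintegral_affineB (expR (t + e)) M2 P'1 f'i g'i.
have mh a M : measurable_fun setT (fun x => a * g x + M - f x).
  by apply: measurable_funB => //; apply: measurable_funD => //;
    exact: measurable_funM.
have h1 x : 0 <= expR (t - e) * g x + M1 - f x by rewrite subr_ge0.
have h2 x : 0 <= expR (t + e) * g x + M2 - f x by rewrite subr_ge0.
have := Rintegral_le_of_measure_le (expR_ge0 e) P'P h1 (mh _ _) i1.
have := Rintegral_le_of_measure_le (expR_ge0 e) PP' h2 (mh _ _) i2.
rewrite {}I1 {}I1' {}I2 {}I2' !expRD expRN.
have : 1 < expR e by rewrite expR_gt1.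
move: (expR e) (expR t) (\int[P]_x f x) (\int[P']_x f x) (\int[P]_x g x)
  (\int[P']_x g x) => E Y p p' q q' E1 Ha Hb.
have EV : E * E^-1 = 1 by rewrite divff// gt_eqF// (lt_trans _ E1).
(* The goal times [E - 1] is the sum of [Ha] and [E] times [Hb], in which the cross terms [q] and
   [p'] cancel. *)
rewrite -(@ler_pM2l _ (E - 1)) ?subr_gt0//.
have {}Hb : E * (Y / E * q' + M1 - p') <= E * (E * (Y / E * q + M1 - p)).
  by rewrite ler_pM2l// (lt_trans _ E1).
have EL : E * (Y / E * q' + M1 - p') = Y * q' * (E * E^-1) + E * M1 - E * p'.
  by ring.
have ER : E * (E * (Y / E * q + M1 - p)) =
  E * Y * q * (E * E^-1) + E * E * M1 - E * E * p by ring.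
rewrite {}EL {}ER EV !mulr1 in Hb.
lra.
Qed.

(** * Bregman projection: scaling constant, stability under a new constraint, measurability *)

Lemma ler_sum_eq (R : realType) (I : finType) (f g : I -> R) :
  (forall i, f i <= g i) -> \sum_i g i <= \sum_i f i -> f =1 g.
Proof.
move=> fg gf i; apply/eqP; rewrite eq_sym -subr_eq0; apply/eqP.
apply: (@psumr_eq0P R I xpredT (fun i => g i - f i)) => //.
  by move=> j _; rewrite subr_ge0.
by apply/eqP; rewrite sumrB subr_eq0 eq_le gf ler_sum.
Qed.

Definition capped_mass (R : realType) (m : nat) (w : m.-tuple R) (c : R) : R :=
  \sum_(i < m) Num.min 1 (c * tnth w i).

Section Bregman.
Variables (R : realType) (s m : nat) (w : m.-tuple R).
Hypothesis w_gt0 : forall i, 0 < tnth w i.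

Lemma capped_weight_le (c c' : R) i : c <= c' ->
  Num.min 1 (c * tnth w i) <= Num.min 1 (c' * tnth w i).
Proof.
move=> cc'; have h : c * tnth w i <= c' * tnth w i by rewrite ler_pM2r.
by rewrite le_min !ge_min lexx h orbT.
Qed.

Lemma capped_mass_le (c c' : R) : c <= c' -> capped_mass w c <= capped_mass w c'.
Proof. by move=> cc'; apply: ler_sum => i _; exact: capped_weight_le. Qed.

Lemma continuous_capped_mass : continuous (capped_mass w).
Proof.
apply: continuous_big => // [|i _].
  exact: add_continuous.
move=> c; apply: (@continuous_min _ _ (fun=> 1) (fun c : R => c * tnth w i)).
  exact: cvg_cst.
exact: mulrr_continuous.
Qed.

Lemma capped_mass_surj : (s <= m)%N ->
  exists2 c, 0 <= c & capped_mass w c = s%:R.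
Proof.
move=> sm.
(* At [c1] every weight reaches the cap 1, so the capped mass is [m]; it is 0 at 0, and the
   intermediate value theorem gives [s] in between. *)
pose c1 := \sum_(i < m) (tnth w i)^-1.
have V0 i : 0 <= (tnth w i)^-1 by rewrite invr_ge0 ltW.
have c10 : 0 <= c1 by exact: sumr_ge0.
have h0 : capped_mass w 0 = 0.
  by rewrite /capped_mass big1// => i _; rewrite mul0r min_r.
have h1 : capped_mass w c1 = m%:R.
  rewrite /capped_mass (eq_bigr (fun=> 1)) ?sumr_const ?card_ord// => i _.
  rewrite min_l// -ler_pdivrMr// mul1r /c1 (bigD1 i)//= lerDl.
  exact: sumr_ge0.
have [||c] := @IVT R (capped_mass w) 0 c1 s%:R c10.
- by apply: continuous_subspaceT => x; exact: continuous_capped_mass.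
- by rewrite h0 h1 min_l// max_r// ler0n ler_nat.
- by rewrite in_itv/= => /andP[c0 _] <-; exists c.
Qed.

Hypothesis sm : (s <= m)%N.

Lemma bregman_constP :
  0 <= bregman_const s w /\ capped_mass w (bregman_const s w) = s%:R.
Proof.
have [c c0 cs] := capped_mass_surj sm.
rewrite /bregman_const; apply: (@xgetPex _ _ [set c | 0 <= c /\ _ = s%:R]).
by exists c.
Qed.

(* Even where the scaling constant is not unique, it yields the same capped
   weights: these are monotone in the constant and have a fixed sum. *)
Lemma tnth_bregman_proj (c : R) i : capped_mass w c = s%:R ->
  tnth (bregman_proj s w) i = s%:R^-1 * Num.min 1 (c * tnth w i).
Proof.
have [_ cs] := bregman_constP => cs'.
rewrite tnth_mktuple; congr (_ * _).
have [cc|/ltW cc] := leP (bregman_const s w) c.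
  apply: (ler_sum_eq (f := fun i => Num.min 1 (_ * tnth w i))
    (g := fun i => Num.min 1 (_ * tnth w i))) => [j|].
    exact: capped_weight_le.
  by rewrite -[X in X <= _]/(capped_mass w c) cs' -cs.
apply/esym; apply: (ler_sum_eq (f := fun i => Num.min 1 (_ * tnth w i))
    (g := fun i => Num.min 1 (_ * tnth w i))) => [j|].
  exact: capped_weight_le.
by rewrite -[X in X <= _]/(capped_mass w _) cs -cs'.
Qed.

Hypothesis s_gt0 : (0 < s)%N.

Lemma bregman_proj_bounds i : 0 <= tnth (bregman_proj s w) i <= s%:R^-1.
Proof.
have [c0 _] := bregman_constP; rewrite tnth_mktuple.
have s0 : 0 < s%:R :> R by rewrite ltr0n.
rewrite mulr_ge0 ?invr_ge0 ?ler0n//=; last first.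
  by rewrite le_min ler01 mulr_ge0// ltW.
by rewrite -[leRHS]mulr1 ler_pM2l ?invr_gt0// ge_min lexx.
Qed.

Lemma is_distribution_bregman_proj : is_distribution (bregman_proj s w).
Proof.
split=> [i|]; first by have /andP[] := bregman_proj_bounds i.
have [_ cs] := bregman_constP.
under eq_bigr do rewrite tnth_mktuple.
by rewrite -mulr_sumr -/(capped_mass w _) cs mulVf// pnatr_eq0 -lt0n.
Qed.

Lemma linf_norm_bregman_proj : linf_norm (bregman_proj s w) <= s%:R^-1.
Proof.
apply/bigmax_leP; split=> [|i _]; first by rewrite invr_ge0.
by have /andP[y0 ys] := bregman_proj_bounds i; rewrite ger0_norm.
Qed.

(* The right-hand side does not involve the scaling constant, so it gives the
   measurability of the projection. *)
Lemma min_bregman_const_le (a : R) i : 0 <= a < 1 ->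
  (Num.min 1 (bregman_const s w * tnth w i) <= a) =
  (s%:R * tnth w i <= \sum_(j < m) Num.min (tnth w i) (a * tnth w j)).
Proof.
move=> /andP[a0 a1]; have [c0 cs] := bregman_constP.
have wi := w_gt0 i; have wi0 : tnth w i != 0 by rewrite gt_eqF.
have -> : \sum_(j < m) Num.min (tnth w i) (a * tnth w j) =
    capped_mass w (a / tnth w i) * tnth w i.
  rewrite /capped_mass mulr_suml; apply: eq_bigr => j _.
  by rewrite minr_pMl ?(ltW wi)// mul1r; congr Num.min; field.
rewrite ler_pM2r//; apply/idP/idP => [|sa].
  rewrite ge_min leNgt a1/= -ler_pdivlMr// => ca.
  by rewrite -cs capped_mass_le.
(* If [a / tnth w i] lies below the scaling constant, its capped mass is still at least [s], so both
   constants give the same capped weights, and the one at [i] is at most [a]. *)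
have [ca|/ltW ac] := leP (bregman_const s w) (a / tnth w i).
  by rewrite ge_min -ler_pdivlMr// ca orbT.
have <- : Num.min 1 (a / tnth w i * tnth w i) =
    Num.min 1 (bregman_const s w * tnth w i).
  apply: (ler_sum_eq (f := fun j => Num.min 1 (a / tnth w i * tnth w j))
    (g := fun i => Num.min 1 (bregman_const s w * tnth w i))) => [j|].
    exact: capped_weight_le.
  by rewrite -[X in X <= _]/(capped_mass w _) cs.
by rewrite divfK// ge_min lexx orbT.
Qed.

End Bregman.

(** The algorithm starts from an unprojected uniform query; this identity makes its first round of
    the same form as the later ones. The scaling constant [s] is admissible. *)
Lemma bregman_proj_uniform (R : realType) (s m : nat) :
  (0 < s <= m)%N ->
  bregman_proj s (uniform_tuple R m) = uniform_tuple R m.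
Proof.
move=> /andP[s0 sm].
have m0 : (0 < m)%N by exact: leq_trans sm.
have mR0 : 0 < m%:R :> R by rewrite ltr0n.
have sE : Num.min 1 (s%:R * m%:R^-1) = s%:R / m%:R :> R.
  by rewrite min_r// ler_pdivrMr// mul1r ler_nat.
apply: eq_from_tnth => i; rewrite (@tnth_bregman_proj _ _ _ _ _ _ s%:R)//.
- by rewrite !tnth_mktuple sE mulrA mulVf ?mul1r// pnatr_eq0 -lt0n.
- by move=> j; rewrite tnth_mktuple invr_gt0.
- rewrite /capped_mass; under eq_bigr do rewrite tnth_mktuple sE.
  by rewrite sumr_const card_ord -[_ *+ m]mulr_natr divfK// gt_eqF.
Qed.

Lemma l1_dist_extE (R : realType) (m : nat) (y : m.-tuple R)
    (y' : m.+1.-tuple R) :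
  l1_dist_ext y y' = \sum_(i < m) `|tnth y i - tnth y' (widen_ord (leqnSn m) i)|
    + `|tnth y' ord_max|.
Proof.
rewrite /l1_dist_ext big_ord_recr; congr (_ + _).
  apply: eq_bigr => i _; congr `|_ - _|.
  by rewrite !(tnth_nth 0)/= nth_rcons size_tuple ltn_ord.
by rewrite (tnth_nth 0)/= nth_rcons size_tuple ltnn eqxx sub0r normrN.
Qed.

(** On the common constraints both projections are capped multiples of [w], so one dominates the
    other at every coordinate and the distance there is a difference of total masses. As both totals
    are 1, that difference is, up to sign, the weight of the extra constraint, which is at most
    [1 / s]. *)
Lemma l1_dist_bregman_proj (R : realType) (s m : nat) (w : m.-tuple R)
    (w' : m.+1.-tuple R) (r : R) :
  (0 < s <= m)%N ->
  (forall i, 0 < tnth w i) -> (forall i, 0 < tnth w' i) -> 0 < r ->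
  (forall i, tnth w' (widen_ord (leqnSn m) i) = r * tnth w i) ->
  l1_dist_ext (bregman_proj s w) (bregman_proj s w') <= 2 / s%:R.
Proof.
move=> /andP[s0 sm] w0 w'0 r0 w'w.
have sm' : (s <= m.+1)%N by exact: leqW.
have [_] := is_distribution_bregman_proj w0 sm s0.
have [_] := is_distribution_bregman_proj w'0 sm' s0.
have /andP[y'0 y's] := bregman_proj_bounds w'0 sm' s0 ord_max.
have s1 : 0 < s%:R^-1 :> R by rewrite invr_gt0 ltr0n.
pose y i := tnth (bregman_proj s w) i.
pose y' i := tnth (bregman_proj s w') (widen_ord (leqnSn m) i).
rewrite l1_dist_extE big_ord_recr/= (ger0_norm y'0) -/(\sum_i y i) -/(\sum_i y' i).
rewrite (_ : \sum_i `| _ - _ | = \sum_(i < m) `|y i - y' i|)//.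
have yE i : y i = s%:R^-1 * Num.min 1 (bregman_const s w * tnth w i).
  by rewrite /y tnth_mktuple.
have y'E i : y' i = s%:R^-1 * Num.min 1 (bregman_const s w' * r * tnth w i).
  by rewrite /y' tnth_mktuple w'w mulrA.
have [cc|/ltW cc] := leP (bregman_const s w' * r) (bregman_const s w).
  have -> : \sum_(i < m) `|y i - y' i| = \sum_(i < m) y i - \sum_(i < m) y' i.
    rewrite -sumrB; apply: eq_bigr => i _; rewrite ger0_norm// subr_ge0.
    by rewrite yE y'E ler_pM2l//; exact: capped_weight_le.
  lra.
have -> : \sum_(i < m) `|y i - y' i| = \sum_(i < m) y' i - \sum_(i < m) y i.
  rewrite -sumrB; apply: eq_bigr => i _; rewrite ler0_norm ?opprB// subr_le0.
  by rewrite yE y'E ler_pM2l//; exact: capped_weight_le.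
lra.
Qed.

Lemma measurable_bregman_proj (R : realType) {d} (X : measurableType d)
    (s m : nat) (f : X -> m.-tuple R) :
  (0 < s <= m)%N -> (forall x i, 0 < tnth (f x) i) ->
  measurable_fun setT f ->
  measurable_fun setT (fun x => bregman_proj s (f x)).
Proof.
move=> /andP[s0 sm] f0 /measurable_fun_tnthP mf.
apply/measurable_fun_tnthP => i.
rewrite (_ : _ \o _ = fun x => s%:R^-1 *
  Num.min 1 (bregman_const s (f x) * tnth (f x) i)); last first.
  by apply/funext => x /=; rewrite tnth_mktuple.
apply: measurable_funM => // _.
apply: (measurability _ (RGenOInfty.measurableE R)) => // _ [_ [a ->] <-].
rewrite setTI preimage_itvoy.
(* Capped weights lie in [0, 1], so only thresholds [0 <= a < 1] call for the criterion free of the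
   scaling constant. *)
have [a1|a1] := leP 1 a.
  rewrite (_ : [set _ | _] = set0)//; apply/seteqP; split=> x //=.
  by rewrite lt_min ltNge a1.
have [a0|a0] := ltP a 0.
  rewrite (_ : [set _ | _] = setT)//; apply/seteqP; split=> x //= _.
  have [c0 _] := bregman_constP (f0 x) sm.
  by rewrite (lt_le_trans a0)// le_min ler01 mulr_ge0// ltW.
rewrite (_ : [set _ | _] = ~` [set x | s%:R * tnth (f x) i <=
    \sum_(j < m) Num.min (tnth (f x) i) (a * tnth (f x) j)]); last first.
  apply/seteqP; split=> x /=; rewrite -min_bregman_const_le ?a0//.
    by rewrite ltNge => /negP.
  by move=> /negP; rewrite -ltNge.
apply: measurableC; rewrite -[X in measurable X]setTI.
apply: measurable_fun_le => //.
  by apply: measurable_funM => //; exact: mf.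
apply: measurable_sum => j; apply: measurable_minr; first exact: mf.
by apply: measurable_funM => //; exact: mf.
Qed.

(** * The run as a function of its state: measurability and probability bounds *)

Definition kernel_pullback {d1 d2 d3} {X : measurableType d1}
    {Y : measurableType d2} {Z : measurableType d3} {R : realType}
    (f : X -> Y) (mf : measurable_fun setT f) (k : R.-pker Y ~> Z)
  : X -> {measure set Z -> \bar R} := fun x => k (f x).

Section KernelPullback.
Context {d1 d2 d3} {X : measurableType d1} {Y : measurableType d2}
  {Z : measurableType d3} {R : realType}.
Variables (f : X -> Y) (mf : measurable_fun setT f) (k : R.-pker Y ~> Z).

Let measurable_kernel_pullback U : measurable U ->
  measurable_fun setT (kernel_pullback mf k ^~ U).
Proof. by move=> mU; exact: measurableT_comp (measurable_kernel k U mU) mf. Qed.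

HB.instance Definition _ := isKernel.Build _ _ _ _ _ (kernel_pullback mf k)
  measurable_kernel_pullback.

Let prob_kernel_pullback x : kernel_pullback mf k x setT = 1%E.
Proof. exact: prob_kernel. Qed.

HB.instance Definition _ := Kernel_isProbability.Build _ _ _ _ _
  (kernel_pullback mf k) prob_kernel_pullback.

End KernelPullback.

Definition exp_tuple (R : realType) (m : nat) (v : m.-tuple R) : m.-tuple R :=
  [tuple expR (tnth v i) | i < m].

Lemma exp_tuple_gt0 (R : realType) (m : nat) (v : m.-tuple R) i :
  0 < tnth (exp_tuple v) i.
Proof. by rewrite tnth_mktuple expR_gt0. Qed.

Section Run.
Variables (R : realType) (d : nat) (orc : lp_oracle R d) (s : nat)
  (eta rho : R) (m : nat) (A : 'M[R]_(m, d)) (b : 'cV[R]_m) (T : nat)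
  (S : set (d.-tuple R)).

Definition next_state (z : m.-tuple R * d.-tuple R) (x : d.-tuple R) :
    m.-tuple R * d.-tuple R :=
  ([tuple tnth z.1 i - eta * tnth (lp_loss rho A b x) i | i < m],
   add_tuple z.2 x).

(* The state is the pair of the logarithms of the weights and the sum of the
   past iterates; logarithms make every state admissible for the Bregman
   projection, so that measurability holds on the whole space. *)
Definition run_state (k : nat) (z : m.-tuple R * d.-tuple R) : \bar R :=
  dense_mw_run orc s eta rho A b T k
    (bregman_proj s (exp_tuple z.1)) (exp_tuple z.1) z.2 S.

Definition run_prob (k : nat) (z : m.-tuple R * d.-tuple R) : R :=
  fine (run_state k z).

Lemma run_stateS k z : run_state k.+1 z =
  (\int[orc A b (bregman_proj s (exp_tuple z.1))]_x
     run_state k (next_state z x))%E.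
Proof.
apply: eq_integral => x _.
rewrite /run_state -[in RHS]/(next_state z x).
have -> // : mw_update eta (exp_tuple z.1) (lp_loss rho A b x) =
  exp_tuple (next_state z x).1.
by apply: eq_from_tnth => i; rewrite !tnth_mktuple -expRD addrC.
Qed.

Lemma measurable_next_state :
  measurable_fun setT (fun zx => next_state zx.1 zx.2).
Proof.
have m1 i : measurable_fun setT
    (fun zx : (m.-tuple R * d.-tuple R) * d.-tuple R => tnth zx.1.1 i).
  apply: (measurableT_comp (measurable_tnth i)).
  exact: measurableT_comp measurable_fst measurable_fst.
have m2 i : measurable_fun setT
    (fun zx : (m.-tuple R * d.-tuple R) * d.-tuple R => tnth zx.1.2 i).
  apply: (measurableT_comp (measurable_tnth i)).
  exact: measurableT_comp measurable_snd measurable_fst.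
have mx i : measurable_fun setT
    (fun zx : (m.-tuple R * d.-tuple R) * d.-tuple R => tnth zx.2 i).
  by apply: (measurableT_comp (measurable_tnth i)); exact: measurable_snd.
apply: measurable_fun_pair; apply/measurable_fun_tnthP => i /=.
  rewrite (_ : _ \o _ = fun zx : (m.-tuple R * d.-tuple R) * d.-tuple R =>
      tnth zx.1.1 i - eta *
      ((2 * rho)^-1 * (b i 0 - \sum_(j < d) A i j * tnth zx.2 j) + 2^-1)); last first.
    by apply/funext => x /=; rewrite !tnth_mktuple.
  apply: measurable_funB => //; apply: measurable_funM => //.
  apply: measurable_funD => //; apply: measurable_funM => //.
  apply: measurable_funB => //; apply: measurable_sum => j.
  exact: measurable_funM.
rewrite (_ : _ \o _ = fun zx : (m.-tuple R * d.-tuple R) * d.-tuple R =>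
    tnth zx.1.2 i + tnth zx.2 i); last first.
  by apply/funext => x /=; rewrite !tnth_mktuple.
exact: measurable_funD.
Qed.

Hypothesis sm : (0 < s <= m)%N.

Lemma measurable_query : measurable_fun setT
  (fun z : m.-tuple R * d.-tuple R => bregman_proj s (exp_tuple z.1)).
Proof.
apply: measurable_bregman_proj => // [z i|]; first exact: exp_tuple_gt0.
apply/measurable_fun_tnthP => i.
rewrite (_ : _ \o _ = fun z : m.-tuple R * d.-tuple R => expR (tnth z.1 i)); last first.
  by apply/funext => x /=; rewrite tnth_mktuple.
apply: measurableT_comp => //.
by apply: (measurableT_comp (measurable_tnth i)); exact: measurable_fst.
Qed.

Hypothesis mS : measurable S.

(** The two claims share one induction: the upper bound on the integral uses measurability of the
    integrand, and measurability of the integral uses its nonnegativity. *)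
Lemma run_state_bounds_measurable k :
  (forall z, (0 <= run_state k z <= 1)%E) /\ measurable_fun setT (run_state k).
Proof.
elim: k => [|k [k01 mk]].
  split=> [z|].
    by rewrite /run_state/= diracE; case: (_ \in S); rewrite /= ?lexx ?lee01.
  rewrite (_ : run_state 0 = fun z => (\1_S
      ([tuple T%:R^-1 * tnth z.2 j | j < d] : d.-tuple R))%:E)//.
  apply/measurable_EFinP.
  apply: (@measurableT_comp _ _ _ _ _ _ (\1_S : d.-tuple R -> R)).
    exact: measurable_indic.
  apply/measurable_fun_tnthP => i.
  rewrite (_ : _ \o _ = fun z : m.-tuple R * d.-tuple R =>
      T%:R^-1 * tnth z.2 i); last first.
    by apply/funext => x /=; rewrite tnth_mktuple.
  apply: measurable_funM => //.
  by apply: (measurableT_comp (measurable_tnth i)); exact: measurable_snd.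
have mnext : measurable_fun setT (fun zx => run_state k (next_state zx.1 zx.2)).
  exact: measurableT_comp mk measurable_next_state.
split=> [z|].
  rewrite run_stateS; apply/andP; split.
    by apply: integral_ge0 => x _; have /andP[] := k01 (next_state z x).
  have <- := @prob_kernel _ _ _ _ _ (orc A b) (bregman_proj s (exp_tuple z.1)).
  rewrite -[leRHS]mul1e -integral_cst//.
  apply: ge0_le_integral => //.
  - by move=> x _; have /andP[] := k01 (next_state z x).
  - exact: (measurable_fun_pair2 z mnext).
  - by move=> x _; have /andP[] := k01 (next_state z x).
(* The oracle sees the state only through the query, so its kernel is pulled back along the
   measurable query map to a kernel on states. *)
rewrite (_ : run_state k.+1 = fun z =>
    \int[kernel_pullback measurable_query (orc A b) z]_x
      run_state k (next_state z x))%E; last first.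
  by apply/funext => z; rewrite run_stateS.
apply: (measurable_fun_integral_finite_kernel
  (fun zx => run_state k (next_state zx.1 zx.2))
  (kernel_pullback measurable_query (orc A b))) => // zx.
by have /andP[] := k01 (next_state zx.1 zx.2).
Qed.

Lemma run_stateE k z : run_state k z = (run_prob k z)%:E.
Proof.
have [k01 _] := run_state_bounds_measurable k.
have /andP[z0 z1] := k01 z.
by rewrite /run_prob fineK// ge0_fin_numE// (le_lt_trans z1)// ltry.
Qed.

Lemma run_prob_bounds k z : 0 <= run_prob k z <= 1.
Proof.
have [k01 _] := run_state_bounds_measurable k.
by rewrite -!lee_fin -run_stateE.
Qed.

Lemma measurable_run_prob_next k z :
  measurable_fun setT (fun x => run_prob k (next_state z x)).
Proof.
apply/measurable_EFinP; under [_ \o _]eq_fun do rewrite /= -run_stateE.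
apply: (@measurable_fun_pair2 _ _ _ _ _ _
  (fun zx => run_state k (next_state zx.1 zx.2))).
apply: measurableT_comp measurable_next_state.
by have [] := run_state_bounds_measurable k.
Qed.

Lemma run_probS k z : run_prob k.+1 z =
  \int[orc A b (bregman_proj s (exp_tuple z.1))]_x run_prob k (next_state z x).
Proof.
rewrite /run_prob run_stateS /Rintegral; congr fine.
by apply: eq_integral => x _; rewrite run_stateE.
Qed.

End Run.

(** * Comparison of two neighbouring runs, by induction on the remaining rounds *)

Lemma lift_ord_max (m : nat) (i : 'I_m) : lift ord_max i = widen_ord (leqnSn m) i.
Proof. by apply: val_inj; exact: lift_max. Qed.

Lemma tnth_lp_loss_appends (R : realType) (d m : nat) (rho : R)
    (A : 'M[R]_(m, d)) (b : 'cV[R]_m) (A' : 'M[R]_(m.+1, d)) (b' : 'cV[R]_m.+1)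
    (x : d.-tuple R) i :
  appends_constraint A b A' b' ->
  tnth (lp_loss rho A' b' x) (widen_ord (leqnSn m) i) = tnth (lp_loss rho A b x) i.
Proof.
move=> [<- <-]; rewrite !tnth_mktuple !mxE lift_ord_max.
by under [in RHS]eq_bigr do rewrite mxE lift_ord_max.
Qed.

(* The bound is required for every real [t]: at a round where the privacy loss
   is [l], the induction hypothesis is used at [t - l]. *)
Lemma dense_mw_run_privacy (R : realType) (d : nat) (orc : lp_oracle R d)
    (s : nat) (eta rho e mu : R) (m : nat)
    (A : 'M[R]_(m, d)) (b : 'cV[R]_m) (A' : 'M[R]_(m.+1, d)) (b' : 'cV[R]_m.+1)
    (T : nat) (S : set (d.-tuple R)) :
  (0 < s <= m)%N -> measurable S -> 0 < e -> 0 <= mu ->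
  private_oracle s orc e -> appends_constraint A b A' b' ->
  forall k (v : m.-tuple R) (v' : m.+1.-tuple R) u t r,
  (forall i, tnth v' (widen_ord (leqnSn m) i) = tnth v i + r) ->
  run_prob orc s eta rho A b T S k (v, u) <=
    expR t * run_prob orc s eta rho A' b' T S k (v', u) +
    expR (k%:R * (mu * (mu + 1) * e ^+ 2 / 2) - mu * t).
Proof.
move=> sm mS e0 mu0 orcP adj.
have [s0 sm1] := andP sm.
have sm' : (0 < s <= m.+1)%N by rewrite s0 leqW.
set K := mu * (mu + 1) * e ^+ 2 / 2.
elim=> [|k IHk] v v' u t r v'v.
  (* Both runs output the same average of [u], so the event has the same indicator; one of [expR t]
     and [expR (- (mu * t))] is at least 1. *)
  rewrite /run_prob /run_state/= indicE mul0r sub0r.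
  have Et := expR_gt0 t; have Emt := expR_gt0 (- (mu * t)).
  case: (_ \in S) => /=; last by rewrite mulr0 add0r ltW.
  rewrite mulr1; have [t0|/ltW t0] := leP 0 t.
    have : 1 <= expR t by rewrite -[leLHS]expR0 ler_expR.
    lra.
  have : 1 <= expR (- (mu * t)).
    by rewrite -[leLHS]expR0 ler_expR -mulrN mulr_ge0// oppr_ge0.
  lra.
rewrite !run_probS//=.
set y := bregman_proj s (exp_tuple v).
set y' := bregman_proj s (exp_tuple v').
have wE i : tnth (exp_tuple v') (widen_ord (leqnSn m) i) =
    expR r * tnth (exp_tuple v) i.
  by rewrite !tnth_mktuple v'v addrC expRD.
have dy : l1_dist_ext y y' <= 2 / s%:R.
  exact: (l1_dist_bregman_proj sm (exp_tuple_gt0 v) (exp_tuple_gt0 v')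
    (expR_gt0 r) wE).
have orcyy' := orcP m y A b y' A' b'
  (is_distribution_bregman_proj (exp_tuple_gt0 v) sm1 s0)
  (is_distribution_bregman_proj (exp_tuple_gt0 v') (leqW sm1) s0)
  (linf_norm_bregman_proj (exp_tuple_gt0 v) sm1 s0)
  (linf_norm_bregman_proj (exp_tuple_gt0 v') (leqW sm1) s0) dy adj.
pose f x := run_prob orc s eta rho A b T S k (next_state eta rho A b (v, u) x).
pose g x := run_prob orc s eta rho A' b' T S k (next_state eta rho A' b' (v', u) x).
have fg t' x : f x <= expR t' * g x + expR (k%:R * K - mu * t').
  (* The same iterate [x] causes equal losses on the common constraints, so the shift [r] of the
     logarithms is preserved. *)
  apply: (IHk _ _ _ _ r) => i.
  rewrite /= (tnth_mktuple _ (widen_ord _ i)) (tnth_mktuple _ i) v'v.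
  by rewrite (tnth_lp_loss_appends _ _ _ adj); ring.
have := @pure_privacy_integral_le _ _ R (orc m A b y) (orc m.+1 A' b' y')
  e t (expR (k%:R * K - mu * (t - e))) (expR (k%:R * K - mu * (t + e))) f g e0
  (@prob_kernel _ _ _ _ _ (orc m A b) y)
  (@prob_kernel _ _ _ _ _ (orc m.+1 A' b') y')
  (fun B mB => (orcyy' B mB).1) (fun B mB => (orcyy' B mB).2)
  (measurable_run_prob_next orc eta rho A b T sm mS k (v, u))
  (measurable_run_prob_next orc eta rho A' b' T sm' mS k (v', u))
  (fun x => run_prob_bounds orc eta rho A b T sm mS k _)
  (fun x => run_prob_bounds orc eta rho A' b' T sm' mS k _)
  (fg _) (fg _).
have -> : expR e * expR (k%:R * K - mu * (t - e)) + expR (k%:R * K - mu * (t + e)) =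
    expR (k%:R * K - mu * t) * (expR (e * (1 + mu)) + expR (- (e * mu))).
  by rewrite [RHS]mulrDr -!expRD; congr (expR _ + expR _); ring.
have mgf := randomized_response_mgf (ltW e0) mu0.
move=> H; rewrite -(@ler_pM2l _ (1 + expR e)) ?addr_gt0 ?expR_gt0//.
apply: (le_trans H); rewrite [leRHS]mulrDr lerD2l.
have -> : k.+1%:R * K - mu * t = k%:R * K - mu * t + K by rewrite -natr1; ring.
by rewrite [expR (_ + K)]expRD [leRHS]mulrCA ler_pM2l ?expR_gt0.
Qed.

(** * The uniform start and the choice of parameters *)

Lemma dense_mw_lpE (R : realType) (d : nat) (orc : lp_oracle R d) (s : nat)
    (rho alpha : R) (n m : nat) (A : 'M[R]_(m, d)) (b : 'cV[R]_m)
    (S : set (d.-tuple R)) : (0 < s <= m)%N -> measurable S ->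
  dense_mw_lp orc s rho alpha n b A S =
  (run_prob orc s (dense_mw_rate rho alpha n) rho A b
    (dense_mw_rounds rho alpha n) S (dense_mw_rounds rho alpha n)
    ([tuple ln (m%:R^-1) | i < m], [tuple 0 | j < d]))%:E.
Proof.
move=> sm mS; rewrite -run_stateE// /run_state/= /dense_mw_lp.
have /andP[s0 sm1] := sm.
have -> : exp_tuple [tuple ln (m%:R^-1) | i < m] = uniform_tuple R m.
  apply: eq_from_tnth => i; rewrite !tnth_mktuple lnK// posrE invr_gt0 ltr0n.
  exact: leq_trans sm1.
by rewrite bregman_proj_uniform.
Qed.

Theorem theorem12 (R : realType) (d : nat) (orc : lp_oracle R d)
    (s n : nat) (rho alpha eps delta : R)
    (hs : (0 < s)%N) (hrho : 0 < rho) (halpha : 0 < alpha)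
    (heps : 0 < eps) (hdelta : 0 < delta)
    (hed : delta < 1 -> eps <= 8 * ln (1 / delta)) :
  let T := dense_mw_rounds rho alpha n in
  let eps' := eps / Num.sqrt (8 * T%:R * ln (1 / delta)) in
  private_oracle s orc eps' ->
  high_sensitivity_constraint_private s
    (dense_mw_lp orc s rho alpha n) eps delta.
Proof.
move=> T e orcP m sm A b A' b' adj S mS.
have sm1 : (0 < s <= m)%N by rewrite hs.
have sm1' : (0 < s <= m.+1)%N by rewrite hs leqW.
rewrite !dense_mw_lpE// -/T -EFinM -EFinD lee_fin.
set p := run_prob _ _ _ _ _ _ _ _ _ _; set p' := run_prob _ _ _ _ _ _ _ _ _ _.
have /andP[p0 p1] : 0 <= p <= 1 by exact: run_prob_bounds.
have /andP[p'0 p'1] : 0 <= p' <= 1 by exact: run_prob_bounds.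
have [delta1|delta1] := leP 1 delta.
  by rewrite (le_trans p1)// (le_trans delta1)// lerDr mulr_ge0// expR_ge0.
set L := ln (1 / delta) in e orcP hed.
have epsL : eps <= 8 * L by exact: hed.
have L0 : 0 < L by lra.
have deltaE : delta = expR (- L).
  by rewrite expRN /L div1r lnK ?posrE ?invr_gt0// invrK.
(* With no rounds [e] is a division by zero, hence 0, and both runs return the same constant
   vector. *)
have [T0|T0] := posnP T.
  have -> : p = p' by rewrite /p /p' T0.
  have : 1 <= expR eps by rewrite -[leLHS]expR0 ler_expR ltW.
  by move=> /(ler_wpM2r p'0); rewrite mul1r => /le_trans; apply; rewrite lerDl ltW.
have T0R : 0 < T%:R :> R by rewrite ltr0n.
have TL0 : 0 < 8 * T%:R * L by rewrite !mulr_gt0.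
have e0 : 0 < e by rewrite divr_gt0// sqrtr_gt0.
have e2 : e ^+ 2 = eps ^+ 2 / (8 * T%:R * L).
  by rewrite expr_div_n sqr_sqrtr// ltW.
pose mu := 4 * L / eps.
have mu0 : 0 <= mu by rewrite divr_ge0// ?mulr_ge0// ltW.
(* The two uniform starts differ only by normalisation, which gives the shift [r]. *)
apply: (le_trans (dense_mw_run_privacy (dense_mw_rate rho alpha n) rho T sm1 mS
  e0 mu0 orcP adj T _ (v' := [tuple ln (m.+1%:R^-1) | i < m.+1])
  (r := ln (m.+1%:R^-1) - ln (m%:R^-1)) eps _)) => [i|].
  by rewrite !tnth_mktuple addrC subrK.
rewrite lerD2l deltaE ler_expR e2 /mu.
(* The exponent is [eps / 4 - 3 * L], which is at most [- L] exactly when [eps <= 8 * L]. *)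
have -> : T%:R * (4 * L / eps * (4 * L / eps + 1) * (eps ^+ 2 / (8 * T%:R * L)) / 2) -
    4 * L / eps * eps = L + eps / 4 - 4 * L.
  by field; rewrite !gt_eqF.
lra.
Qed.
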